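(* Let $\Phi\subset\mathbb{R}^3$ be a skew ruled surface of class $C^3$, parametrized by $\boldsymbol{x}(u,v)=\boldsymbol{s}(u)+v\,\boldsymbol{e}(u)$, $(u,v)\in I\times\mathbb{R}$, as in the context, with conical curvature $k(u)$, distribution parameter $\delta(u)$ and $w=\sqrt{v^2+\delta(u)^2}$. Suppose that the normal curvature $k_N$ along the curves of constant Gaussian curvature, i.e. the curves determined by $$\delta'(\delta^2-v^2)\,du+2\delta v\,dv=0,$$ has the form $$k_N=f(u)\,w^{n}$$ at every point $(u,v)\in I\times\mathbb{R}$ at which this equation determines a direction, with some $n\in\mathbb{Z}$ and some continuous function $f:I\to\mathbb{R}$. Then one of the following holds: (a) $f=0$ and $\Phi$ is a (right) helicoid. (b) $n=-1$, $f(u)=-k(u)$, and $\Phi$ is an orthoid of constant distribution parameter or an Edlinger surface.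
   Context: Setting. $I\subset\mathbb{R}$ is an open interval and $\Phi$ is a regular ruled surface in Euclidean space $\mathbb{R}^3$ without torsal generators (''skew''), of class $C^3$ on $I\times\mathbb{R}$, with parametrization $\boldsymbol{x}(u,v)=\boldsymbol{s}(u)+v\,\boldsymbol{e}(u)$, where $\boldsymbol{s}$ is the striction line and $\boldsymbol{e}$ is the unit vector along the generators. Prime denotes $d/du$. It is assumed that $\langle \boldsymbol{s}'(u),\boldsymbol{e}'(u)\rangle=0$ and $|\boldsymbol{e}'(u)|=1$ for all $u\in I$. Moving frame: $\boldsymbol{n}:=\boldsymbol{e}'$, $\boldsymbol{z}:=\boldsymbol{e}\times\boldsymbol{n}$. Invariants (with $(\cdot,\cdot,\cdot)$ the triple product): conical curvature $k=(\boldsymbol{e},\boldsymbol{e}',\boldsymbol{e}'')$; distribution parameter (Drall) $\delta=(\boldsymbol{e},\boldsymbol{e}',\boldsymbol{s}')$, which is nowhere zero since $\Phi$ is skew; striction $\sigma$, the angle between $\boldsymbol{e}$ and $\boldsymbol{s}'$, and $\lambda:=\cot\sigma=\langle\boldsymbol{e},\boldsymbol{s}'\rangle/\delta$. Thus $\boldsymbol{s}'=\delta\lambda\,\boldsymbol{e}+\delta\,\boldsymbol{z}$. With $u^1=u$, $u^2=v$ and $w:=\sqrt{v^2+\delta^2}$, the fundamental forms (unit normal $(\boldsymbol{x}_u\times\boldsymbol{x}_v)/w$) are $g_{11}=v^2+\delta^2(\lambda^2+1)$, $g_{12}=\delta\lambda$, $g_{22}=1$, $h_{11}=-\frac1w\,[k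 v^2+\delta' v+\delta^2(k-\lambda)]$, $h_{12}=\frac{\delta}{w}$, $h_{22}=0$. The Gaussian curvature is $K=-\delta^2/w^4$; the curves of constant Gaussian curvature are the curves on $\Phi$ along which $K$ is constant. The normal curvature in direction $du:dv$ is $k_N=\dfrac{h_{11}du^2+2h_{12}du\,dv+h_{22}dv^2}{g_{11}du^2+2g_{12}du\,dv+g_{22}dv^2}$; the normal curvature along a curve is that in its tangent direction. Terminology. $\Phi$ is an Edlinger surface if all its osculating quadrics are hyperboloids of revolution; equivalently, $\delta'=0$ and $k\lambda+1=0$ identically on $I$. $\Phi$ is an orthoid if $\lambda=0$ identically on $I$; it has constant distribution parameter if $\delta'=0$ identically. $\Phi$ is a (right) helicoid (Wendelfläche) if $k=\lambda=\delta'=0$ identically on $I$. ''$f=0$'' means that $f$ vanishes identically on $I$. *)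

(* Defs.v *)
From Stdlib Require Import Reals ZArith.
From Coquelicot Require Import Coquelicot.
Open Scope R_scope.

Definition vec : Type := (R * R * R)%type.

Definition coord1 (p : vec) : R := fst (fst p).
Definition coord2 (p : vec) : R := snd (fst p).
Definition coord3 (p : vec) : R := snd p.

Definition dot (p q : vec) : R := coord1 p * coord1 q + coord2 p * coord2 q + coord3 p * coord3 q.

Definition cross (p q : vec) : vec :=
  (coord2 p * coord3 q - coord3 p * coord2 q,
   coord3 p * coord1 q - coord1 p * coord3 q,
   coord1 p * coord2 q - coord2 p * coord1 q).

Definition triple (p q r : vec) : R := dot p (cross q r).

Definition enorm (p : vec) : R := sqrt (dot p p).

(** Derivative of a curve (meaningful where the coordinates are derivable). *)
Definition vderive (c : R -> vec) (t : R) : vec :=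
  (Derive (fun r => coord1 (c r)) t,
   Derive (fun r => coord2 (c r)) t,
   Derive (fun r => coord3 (c r)) t).

Definition rbar_interval (a b : Rbar) (u : R) : Prop :=
  Rbar_lt a u /\ Rbar_lt u b.

(** [D] is meant to be open, so that the total functions [Derive] only see
    the values of [F] on [D]. *)
Fixpoint class_C (k : nat) (D : R -> R -> Prop) (F : R -> R -> R) : Prop :=
  (forall u v, D u v -> continuity_2d_pt F u v) /\
  match k with
  | O => True
  | S j =>
      (forall u v, D u v ->
         ex_derive (fun t => F t v) u /\ ex_derive (fun t => F u t) v) /\
      class_C j D (fun u v => Derive (fun t => F t v) u) /\
      class_C j D (fun u v => Derive (fun t => F u t) v)
  end.

Definition vclass_C (k : nat) (D : R -> R -> Prop) (X : R -> R -> vec) : Prop :=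
  class_C k D (fun u v => coord1 (X u v)) /\
  class_C k D (fun u v => coord2 (X u v)) /\
  class_C k D (fun u v => coord3 (X u v)).

Definition dfst (X : R -> R -> vec) (u v : R) : vec := vderive (fun t => X t v) u.
Definition dsnd (X : R -> R -> vec) (u v : R) : vec := vderive (fun t => X u t) v.

Definition unit_normal (X : R -> R -> vec) (u v : R) : vec :=
  let m := cross (dfst X u v) (dsnd X u v) in scal (/ enorm m) m.

Definition g11 X u v : R := dot (dfst X u v) (dfst X u v).
Definition g12 X u v : R := dot (dfst X u v) (dsnd X u v).
Definition g22 X u v : R := dot (dsnd X u v) (dsnd X u v).

Definition h11 X u v : R := dot (dfst (dfst X) u v) (unit_normal X u v).
Definition h12 X u v : R := dot (dfst (dsnd X) u v) (unit_normal X u v).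
Definition h22 X u v : R := dot (dsnd (dsnd X) u v) (unit_normal X u v).

Definition normal_curvature (X : R -> R -> vec) (u v du dv : R) : R :=
  (h11 X u v * du ^ 2 + 2 * h12 X u v * du * dv + h22 X u v * dv ^ 2) /
  (g11 X u v * du ^ 2 + 2 * g12 X u v * du * dv + g22 X u v * dv ^ 2).

Definition ruled (s e : R -> vec) (u v : R) : vec := plus (s u) (scal v (e u)).

Definition conical_curvature (e : R -> vec) (u : R) : R :=
  triple (e u) (vderive e u) (vderive (vderive e) u).

Definition distribution_parameter (s e : R -> vec) (u : R) : R :=
  triple (e u) (vderive e u) (vderive s u).

(** Cotangent of the striction, the angle between [e] and [s']; the
    normalization by [distribution_parameter] fixes its sign. *)
Definition lambda (s e : R -> vec) (u : R) : R :=
  dot (e u) (vderive s u) / distribution_parameter s e u.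

Definition w (s e : R -> vec) (u v : R) : R := sqrt (v ^ 2 + distribution_parameter s e u ^ 2).

Definition torsal (s e : R -> vec) (u : R) : Prop :=
  triple (e u) (vderive e u) (vderive s u) = 0.

(** A regular skew ruled surface of class C^3 over [I], given by its striction
    line [s] and unit generators [e], where [u] is the arc length of the
    spherical image [e]. *)
Record skew_ruled_surface (I : R -> Prop) (s e : R -> vec) : Prop := {
  srs_C3 : vclass_C 3 (fun u _ => I u) (ruled s e);
  srs_regular : forall u v, I u ->
    cross (dfst (ruled s e) u v) (dsnd (ruled s e) u v) <> zero;
  srs_skew : forall u, I u -> ~ torsal s e u;
  srs_unit : forall u, I u -> enorm (e u) = 1;
  srs_striction : forall u, I u -> dot (vderive s u) (vderive e u) = 0;
  srs_arclength : forall u, I u -> enorm (vderive e u) = 1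
}.

(** The equation [cgc_coef_u du + cgc_coef_v dv = 0] of the curves of constant
    Gaussian curvature: K = - delta^2 / w^4 with delta the distribution
    parameter, and dK is the left-hand side times 2 delta / w^6. *)
Definition cgc_coef_u (s e : R -> vec) (u v : R) : R :=
  Derive (distribution_parameter s e) u * (distribution_parameter s e u ^ 2 - v ^ 2).
Definition cgc_coef_v (s e : R -> vec) (u v : R) : R := 2 * distribution_parameter s e u * v.

Definition cgc_determines_direction (s e : R -> vec) (u v : R) : Prop :=
  (cgc_coef_u s e u v, cgc_coef_v s e u v) <> (0, 0).

Definition cgc_direction (s e : R -> vec) (u v du dv : R) : Prop :=
  (du, dv) <> (0, 0) /\
  cgc_coef_u s e u v * du + cgc_coef_v s e u v * dv = 0.

Definition constant_delta (I : R -> Prop) (s e : R -> vec) : Prop :=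
  forall u, I u -> Derive (distribution_parameter s e) u = 0.

Definition orthoid (I : R -> Prop) (s e : R -> vec) : Prop :=
  forall u, I u -> lambda s e u = 0.

Definition helicoid (I : R -> Prop) (s e : R -> vec) : Prop :=
  forall u, I u ->
    conical_curvature e u = 0 /\ lambda s e u = 0 /\ Derive (distribution_parameter s e) u = 0.

Definition quadratic_polynomial (Q : vec -> R) : Prop :=
  exists a11 a22 a33 a12 a13 a23 b1 b2 b3 c : R,
    forall p, Q p =
      a11 * coord1 p ^ 2 + a22 * coord2 p ^ 2 + a33 * coord3 p ^ 2
      + a12 * (coord1 p * coord2 p) + a13 * (coord1 p * coord3 p) + a23 * (coord2 p * coord3 p)
      + b1 * coord1 p + b2 * coord2 p + b3 * coord3 p + c.

(** The quadric [Q = 0] has contact of second order with the ruled surface at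
    every point of the generator [u] (it is the limit of the quadrics through
    three neighbouring generators).  These are nine linear conditions on the
    ten coefficients of [Q]; along a non-torsal generator they determine [Q] up
    to a nonzero factor. *)
Definition osculating_quadric (s e : R -> vec) (u : R) (Q : vec -> R) : Prop :=
  quadratic_polynomial Q /\
  (exists p, Q p <> 0) /\
  forall (v : R) (i : nat), (i <= 2)%nat ->
    Derive_n (fun t => Q (ruled s e t v)) i u = 0.

(** One sheet: two-sheeted hyperboloids contain no line, hence are never
    osculating quadrics. *)
Definition hyperboloid_of_revolution (S : vec -> Prop) : Prop :=
  exists (center axis : vec) (al be : R),
    enorm axis = 1 /\ 0 < al /\ 0 < be /\
    forall p, S p <->
      let d := minus p center in
      let h := dot d axis in
      (dot d d - h ^ 2) / al ^ 2 - h ^ 2 / be ^ 2 = 1.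

Definition edlinger (I : R -> Prop) (s e : R -> vec) : Prop :=
  forall u, I u ->
    exists Q, osculating_quadric s e u Q /\
              hyperboloid_of_revolution (fun p => Q p = 0).

(* Main.v *)
Require Import Defs.
From Stdlib Require Import Reals ZArith Ranalysis5 Lra Lia Classical.
From Coquelicot Require Import Coquelicot.
Open Scope R_scope.

(** Fix a generator [u] and write [k], [l], [d], [d'] for the conical curvature,
    [lambda], the distribution parameter and its derivative there.  The
    direction [2 d v : d' (v^2 - d^2)] turns the hypothesis into an identity in
    [v],
      [- 4 d^2 v (k v^3 + d^2 (k - l) v + d' d^2) = f w^(n+1) D(v)],
    where [D], the first fundamental form of the direction, is positive at
    [v = 0] unless [d' = 0].

    If [f = 0], the cubic on the left vanishes and [k = l = d' = 0].  If
    [f <> 0], the value at [v = 0] gives [d' = 0], and the identity reduces to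
      [k v^2 + d^2 (k - l) = - f w^(n+1) (v^2 + d^2 (l^2 + 1))].
    Sampled where [w = |d| 2^j], this is a linear relation between the geometric
    progressions [4^j], [1], [(4y)^j], [y^j] with [y = 2^(n+1)]; they are
    independent enough to force [y = 1] ([exponential_relation]), hence
    [n = -1], and then comparing coefficients gives [f = - k] and
    [l (k l + 1) = 0] ([generator_condition]).

    Globally, [n <> -1] thus means [f = k = l = d' = 0] on the whole interval,
    the helicoid.  For [n = -1], the function [k l = - f l] is continuous with
    values in [{0, -1}], hence constant ([two_valued_constant]).  If it is [0],
    then [l = 0] and the surface is an orthoid; if it is [-1], the osculating
    quadrics are written down explicitly as hyperboloids of revolution
    ([edlinger_of_invariants]).

    All computations at a generator take place in the orthonormal frame
    [e], [n = e'], [z = e x n]; inner products are evaluated by [dot_frame]. *)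

(** * Vector algebra in an orthonormal frame *)

Ltac vec_ring :=
  intros; unfold triple, dot, cross; cbn; unfold coord1, coord2, coord3; cbn; ring.

Lemma dot_comm (p q : vec) : dot p q = dot q p.
Proof. vec_ring. Qed.

Lemma dot_plus_scal_l (p q r : vec) (x : R) :
  dot (plus p (scal x q)) r = dot p r + x * dot q r.
Proof.
  unfold dot, coord1, coord2, coord3, plus, scal; cbn; unfold mult, plus; cbn; ring.
Qed.

Lemma dot_plus_scal_r (p q r : vec) (x : R) :
  dot r (plus p (scal x q)) = dot r p + x * dot r q.
Proof. now rewrite dot_comm, dot_plus_scal_l, !(dot_comm r). Qed.

Lemma dot_scal_r (p q : vec) (x : R) : dot p (scal x q) = x * dot p q.
Proof.
  unfold dot, coord1, coord2, coord3, scal; cbn; unfold mult; cbn; ring.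
Qed.

Lemma triple_cyclic (p q r : vec) : triple p q r = dot r (cross p q).
Proof. vec_ring. Qed.

Lemma dot_cross_cross (p q r t : vec) :
  dot (cross p q) (cross r t) = dot p r * dot q t - dot p t * dot q r.
Proof. vec_ring. Qed.

Lemma enorm_1_dot (p : vec) : enorm p = 1 -> dot p p = 1.
Proof.
  unfold enorm; intros h.
  destruct (Rle_dec 0 (dot p p)) as [h0|h0].
  - rewrite <- (sqrt_sqrt _ h0), h; ring.
  - rewrite sqrt_neg_0 in h; lra.
Qed.

(** Cramer's rule: [det (e, n, e x n)] times a vector is a combination of
    [e], [n], [e x n] with polynomial coefficients, which for an orthonormal
    pair are the projections. *)
Lemma dot_frame (e n p q : vec) :
  dot e e = 1 -> dot n n = 1 -> dot e n = 0 ->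
  dot p q = dot p e * dot q e + dot p n * dot q n
            + dot p (cross e n) * dot q (cross e n).
Proof.
  intros he hn hen.
  assert (hz : dot (cross e n) (cross e n) = 1)
    by (rewrite dot_cross_cross, (dot_comm n e), he, hn, hen; ring).
  assert (H : dot p q * dot (cross e n) (cross e n) =
     (dot p e * dot n n - dot p n * dot e n) * dot q e
     + (dot p n * dot e e - dot p e * dot e n) * dot q n
     + dot p (cross e n) * dot q (cross e n)) by vec_ring.
  rewrite hz, he, hn, hen in H; lra.
Qed.

(** * Differentiating curves in space *)

(* [auto_derive] leaves eta-expanded derivands, which [ring] tells apart. *)
Ltac eta_derive :=
  repeat match goal with
  | |- context [Derive (fun y : R => ?f y) ?t] =>
      progress change (Derive (fun y : R => f y) t) with (Derive f t)
  end.
Ltac derive_ring := eta_derive; ring.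

(* The normed-module lemmas leave equations in the carrier of [R]. *)
Ltac real_ring := match goal with |- ?x = ?y => change (@eq R x y) end; ring.

Definition vderivable (c : R -> vec) (t : R) : Prop :=
  ex_derive (fun r => coord1 (c r)) t /\
  ex_derive (fun r => coord2 (c r)) t /\
  ex_derive (fun r => coord3 (c r)) t.

Lemma is_derive_dot (p q : R -> vec) (t : R) :
  vderivable p t -> vderivable q t ->
  is_derive (fun r => dot (p r) (q r)) t
    (dot (vderive p t) (q t) + dot (p t) (vderive q t)).
Proof.
  intros (hp1 & hp2 & hp3) (hq1 & hq2 & hq3).
  set (p1 := fun r => coord1 (p r)) in *; set (q1 := fun r => coord1 (q r)) in *.
  set (p2 := fun r => coord2 (p r)) in *; set (q2 := fun r => coord2 (q r)) in *.
  set (p3 := fun r => coord3 (p r)) in *; set (q3 := fun r => coord3 (q r)) in *.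
  change (is_derive (fun r => p1 r * q1 r + p2 r * q2 r + p3 r * q3 r) t
    (Derive p1 t * q1 t + Derive p2 t * q2 t + Derive p3 t * q3 t
     + (p1 t * Derive q1 t + p2 t * Derive q2 t + p3 t * Derive q3 t))).
  change (ex_derive p1 t) in hp1; change (ex_derive p2 t) in hp2.
  change (ex_derive p3 t) in hp3; change (ex_derive q1 t) in hq1.
  change (ex_derive q2 t) in hq2; change (ex_derive q3 t) in hq3.
  clearbody p1 p2 p3 q1 q2 q3.
  auto_derive; [repeat split; assumption|derive_ring].
Qed.

Lemma is_derive_minor (f g h k : R -> R) (t : R) :
  ex_derive f t -> ex_derive g t -> ex_derive h t -> ex_derive k t ->
  is_derive (fun r => f r * g r - h r * k r) t
    ((Derive f t * g t - Derive h t * k t) + (f t * Derive g t - h t * Derive k t)).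
Proof. intros; auto_derive; [repeat split; assumption|derive_ring]. Qed.

Lemma is_derive_plus_scal (f g : R -> R) (v t : R) :
  ex_derive f t -> ex_derive g t ->
  is_derive (fun r => f r + v * g r) t (Derive f t + v * Derive g t).
Proof. intros; auto_derive; [repeat split; assumption|derive_ring]. Qed.

Lemma vderivable_cross (p q : R -> vec) (t : R) :
  vderivable p t -> vderivable q t -> vderivable (fun r => cross (p r) (q r)) t.
Proof.
  intros (hp1 & hp2 & hp3) (hq1 & hq2 & hq3).
  repeat split; eexists;
    [ apply (is_derive_minor (fun r => coord2 (p r)) (fun r => coord3 (q r))
               (fun r => coord3 (p r)) (fun r => coord2 (q r)))
    | apply (is_derive_minor (fun r => coord3 (p r)) (fun r => coord1 (q r))
               (fun r => coord1 (p r)) (fun r => coord3 (q r)))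
    | apply (is_derive_minor (fun r => coord1 (p r)) (fun r => coord2 (q r))
               (fun r => coord2 (p r)) (fun r => coord1 (q r))) ]; assumption.
Qed.

Lemma vderive_cross (p q : R -> vec) (t : R) :
  vderivable p t -> vderivable q t ->
  vderive (fun r => cross (p r) (q r)) t =
  plus (cross (vderive p t) (q t)) (cross (p t) (vderive q t)).
Proof.
  intros (hp1 & hp2 & hp3) (hq1 & hq2 & hq3).
  unfold vderive at 1; cbn.
  apply (f_equal2 pair); [apply (f_equal2 pair)|];
    apply is_derive_unique;
    [ apply (is_derive_minor (fun r => coord2 (p r)) (fun r => coord3 (q r))
               (fun r => coord3 (p r)) (fun r => coord2 (q r)))
    | apply (is_derive_minor (fun r => coord3 (p r)) (fun r => coord1 (q r))
               (fun r => coord1 (p r)) (fun r => coord3 (q r)))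
    | apply (is_derive_minor (fun r => coord1 (p r)) (fun r => coord2 (q r))
               (fun r => coord2 (p r)) (fun r => coord1 (q r))) ]; assumption.
Qed.

Lemma dot_const_derive (I : R -> Prop) (p q : R -> vec) (c t : R) :
  open I -> (forall r, I r -> dot (p r) (q r) = c) -> I t ->
  vderivable p t -> vderivable q t ->
  dot (vderive p t) (q t) + dot (p t) (vderive q t) = 0.
Proof.
  intros hI h ht hp hq.
  rewrite <- (is_derive_unique _ _ _ (is_derive_dot p q t hp hq)).
  rewrite (Derive_ext_loc _ (fun _ => c)); [apply Derive_const|].
  apply (filter_imp I); [exact h|exact (hI t ht)].
Qed.

(** * Smoothness of the striction line and of the generators *)

Lemma open_rbar_interval (a b : Rbar) : open (rbar_interval a b).
Proof. apply open_and; [apply open_Rbar_gt|apply open_Rbar_lt]. Qed.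

(** The restrictions of the surface to [v = 0] and [v = 1] recover both curves. *)
Lemma class_C_affine (I : R -> Prop) (F : R -> R -> R) (g h : R -> R) :
  open I -> (forall u v, F u v = g u + v * h u) ->
  class_C 3 (fun u _ => I u) F -> forall u, I u ->
  ex_derive g u /\ ex_derive h u /\ ex_derive (Derive g) u /\ ex_derive (Derive h) u.
Proof.
  intros hI hF (_ & hd & (_ & hd2 & _) & _).
  assert (hg : forall u, I u -> ex_derive g u).
  { intros u hu; apply (ex_derive_ext (fun t => F t 0)).
    - intros t; rewrite hF; real_ring.
    - exact (proj1 (hd u 0 hu)). }
  assert (hh : forall u, I u -> ex_derive h u).
  { intros u hu; apply (ex_derive_ext (fun t => F t 1 - F t 0)).
    - intros t; rewrite !hF; real_ring.
    - apply @ex_derive_minus; [exact (proj1 (hd u 1 hu))|exact (proj1 (hd u 0 hu))]. }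
  assert (hD : forall u v, I u -> Derive (fun t => F t v) u = Derive g u + v * Derive h u).
  { intros u v hu.
    rewrite (Derive_ext _ (fun t => g t + v * h t)) by (intros t; apply hF).
    specialize (hg u hu); specialize (hh u hu).
    apply is_derive_unique; auto_derive; [now split|derive_ring]. }
  intros u hu; repeat split; auto.
  - apply (ex_derive_ext_loc (fun t => Derive (fun r => F r 0) t)).
    + apply (filter_imp I); [|exact (hI u hu)].
      intros t ht; rewrite hD by exact ht; real_ring.
    + exact (proj1 (hd2 u 0 hu)).
  - apply (ex_derive_ext_loc
             (fun t => Derive (fun r => F r 1) t - Derive (fun r => F r 0) t)).
    + apply (filter_imp I); [|exact (hI u hu)].
      intros t ht; rewrite !hD by exact ht; real_ring.
    + apply @ex_derive_minus; [exact (proj1 (hd2 u 1 hu))|exact (proj1 (hd2 u 0 hu))].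
Qed.

Lemma ruled_derivable (I : R -> Prop) (s e : R -> vec) :
  open I -> vclass_C 3 (fun u _ => I u) (ruled s e) -> forall u, I u ->
  vderivable s u /\ vderivable e u /\
  vderivable (vderive s) u /\ vderivable (vderive e) u.
Proof.
  intros hI (h1 & h2 & h3) u hu.
  destruct (class_C_affine I _ (fun t => coord1 (s t)) (fun t => coord1 (e t))
              hI (fun _ _ => eq_refl) h1 u hu) as (? & ? & ? & ?).
  destruct (class_C_affine I _ (fun t => coord2 (s t)) (fun t => coord2 (e t))
              hI (fun _ _ => eq_refl) h2 u hu) as (? & ? & ? & ?).
  destruct (class_C_affine I _ (fun t => coord3 (s t)) (fun t => coord3 (e t))
              hI (fun _ _ => eq_refl) h3 u hu) as (? & ? & ? & ?).
  repeat split; assumption.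
Qed.

Lemma vderive_plus_scal (p q : R -> vec) (v t : R) :
  vderivable p t -> vderivable q t ->
  vderive (fun r => plus (p r) (scal v (q r))) t =
  plus (vderive p t) (scal v (vderive q t)).
Proof.
  intros (hp1 & hp2 & hp3) (hq1 & hq2 & hq3).
  unfold vderive at 1.
  apply (f_equal2 pair); [apply (f_equal2 pair)|];
    apply is_derive_unique;
    [ apply (is_derive_plus_scal (fun r => coord1 (p r)) (fun r => coord1 (q r)))
    | apply (is_derive_plus_scal (fun r => coord2 (p r)) (fun r => coord2 (q r)))
    | apply (is_derive_plus_scal (fun r => coord3 (p r)) (fun r => coord3 (q r))) ];
    assumption.
Qed.

Lemma vderivable_plus_scal (p q : R -> vec) (v t : R) :
  vderivable p t -> vderivable q t ->
  vderivable (fun r => plus (p r) (scal v (q r))) t.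
Proof.
  intros (hp1 & hp2 & hp3) (hq1 & hq2 & hq3); repeat split; eexists;
    [ apply (is_derive_plus_scal (fun r => coord1 (p r)) (fun r => coord1 (q r)))
    | apply (is_derive_plus_scal (fun r => coord2 (p r)) (fun r => coord2 (q r)))
    | apply (is_derive_plus_scal (fun r => coord3 (p r)) (fun r => coord3 (q r))) ];
    assumption.
Qed.

Lemma vderive_ext_loc (p q : R -> vec) (t : R) :
  locally t (fun r => p r = q r) -> vderive p t = vderive q t.
Proof.
  intros h; unfold vderive.
  apply (f_equal2 pair); [apply (f_equal2 pair)|]; apply Derive_ext_loc;
    (revert h; apply filter_imp; intros r hr; now rewrite hr).
Qed.

Lemma vderivable_ext_loc (p q : R -> vec) (t : R) :
  locally t (fun r => p r = q r) -> vderivable p t -> vderivable q t.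
Proof.
  intros h (h1 & h2 & h3); repeat split;
    [revert h1|revert h2|revert h3]; apply ex_derive_ext_loc;
    (revert h; apply filter_imp; intros r hr; now rewrite hr).
Qed.

Lemma dsnd_ruled (s e : R -> vec) (u v : R) : dsnd (ruled s e) u v = e u.
Proof.
  unfold dsnd, vderive, ruled.
  rewrite (Derive_ext _ (fun t => coord1 (s u) + t * coord1 (e u))) by reflexivity.
  rewrite (Derive_ext (fun t => coord2 _) (fun t => coord2 (s u) + t * coord2 (e u)))
    by reflexivity.
  rewrite (Derive_ext (fun t => coord3 _) (fun t => coord3 (s u) + t * coord3 (e u)))
    by reflexivity.
  destruct (e u) as ((x & y) & z).
  apply (f_equal2 pair); [apply (f_equal2 pair)|];
    apply is_derive_unique; (auto_derive; [exact Logic.I|]); cbn; ring.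
Qed.

(** * The moving frame *)

(** The data of the surface at one generator, to second order, in components
    along [e], [n = e'], [z = e x n]: [s' = (delta lambda, 0, delta)],
    [e'' = (-1, 0, k)] and [s'' = ( _ , delta (lambda - k), delta')].  The
    component left open is [(delta lambda)']; the second fundamental form sees
    [s''] only through its part orthogonal to [e]. *)
Record frame_equations (s e : R -> vec) (u : R) : Prop := {
  fe_ee : dot (e u) (e u) = 1;
  fe_nn : dot (vderive e u) (vderive e u) = 1;
  fe_en : dot (e u) (vderive e u) = 0;
  fe_s1e : dot (vderive s u) (e u) = distribution_parameter s e u * lambda s e u;
  fe_s1n : dot (vderive s u) (vderive e u) = 0;
  fe_s1z : dot (vderive s u) (cross (e u) (vderive e u)) = distribution_parameter s e u;
  fe_e2e : dot (vderive (vderive e) u) (e u) = -1;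
  fe_e2n : dot (vderive (vderive e) u) (vderive e u) = 0;
  fe_e2z : dot (vderive (vderive e) u) (cross (e u) (vderive e u)) = conical_curvature e u;
  fe_s2n : dot (vderive (vderive s) u) (vderive e u) =
           distribution_parameter s e u * (lambda s e u - conical_curvature e u);
  fe_s2z : dot (vderive (vderive s) u) (cross (e u) (vderive e u)) =
           Derive (distribution_parameter s e) u
}.

Lemma is_derive_distribution_parameter (s e : R -> vec) (u : R) :
  vderivable e u -> vderivable (vderive s) u -> vderivable (vderive e) u ->
  is_derive (distribution_parameter s e) u
    (dot (vderive (vderive s) u) (cross (e u) (vderive e u))
     + triple (e u) (vderive (vderive e) u) (vderive s u)).
Proof.
  intros he hs1 he1.
  apply (is_derive_ext (fun r => dot (vderive s r) (cross (e r) (vderive e r)))).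
  { intros r; symmetry; exact (triple_cyclic (e r) (vderive e r) (vderive s r)). }
  assert (H := is_derive_dot (vderive s) (fun r => cross (e r) (vderive e r)) u hs1
                 (vderivable_cross e (vderive e) u he he1)).
  rewrite vderive_cross in H by assumption.
  assert (E : dot (vderive s u) (plus (cross (vderive e u) (vderive e u))
                                  (cross (e u) (vderive (vderive e) u)))
              = triple (e u) (vderive (vderive e) u) (vderive s u)).
  { generalize (vderive s u) (vderive e u) (e u) (vderive (vderive e) u); intros.
    unfold triple, dot, cross, coord1, coord2, coord3, plus; cbn.
    unfold plus; cbn; ring. }
  rewrite E in H; exact H.
Qed.

(** Everything comes from differentiating [e.e = 1], [e'.e' = 1], [e.e' = 0]
    and [s'.e' = 0] once; the [z]-component of [s''] comes from [delta']. *)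
Lemma skew_frame_equations (I : R -> Prop) (s e : R -> vec) :
  open I -> skew_ruled_surface I s e -> forall u, I u -> frame_equations s e u.
Proof.
  intros hI [hC _ hskew hunit hstr harc] u hu.
  assert (hd := ruled_derivable I s e hI hC).
  assert (hee : forall r, I r -> dot (e r) (e r) = 1)
    by (intros r hr; apply enorm_1_dot, hunit, hr).
  assert (hnn : forall r, I r -> dot (vderive e r) (vderive e r) = 1)
    by (intros r hr; apply enorm_1_dot, harc, hr).
  assert (hen : forall r, I r -> dot (e r) (vderive e r) = 0).
  { intros r hr; destruct (hd r hr) as (_ & h & _).
    assert (H := dot_const_derive I e e 1 r hI hee hr h h).
    rewrite (dot_comm (vderive e r)) in H; lra. }
  destruct (hd u hu) as (hs0 & he0 & hs1 & he1).
  assert (he2n := dot_const_derive I _ _ _ u hI hnn hu he1 he1).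
  assert (he2e := dot_const_derive I _ _ _ u hI hen hu he0 he1).
  assert (hs2n := dot_const_derive I _ _ _ u hI hstr hu hs1 he1).
  specialize (hee u hu); specialize (hnn u hu); specialize (hen u hu).
  specialize (hstr u hu); specialize (hskew u hu); unfold torsal in hskew.
  fold (distribution_parameter s e u) in hskew.
  rewrite (dot_comm (vderive e u) (vderive (vderive e) u)) in he2n.
  rewrite (dot_comm (e u) (vderive (vderive e) u)), hnn in he2e.
  assert (hs1z : dot (vderive s u) (cross (e u) (vderive e u))
                 = distribution_parameter s e u)
    by (unfold distribution_parameter; now rewrite triple_cyclic).
  assert (he2z : dot (vderive (vderive e) u) (cross (e u) (vderive e u))
                 = conical_curvature e u)
    by (unfold conical_curvature; now rewrite triple_cyclic).
  assert (hs1e : dot (vderive s u) (e u) = distribution_parameter s e u * lambda s e u)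
    by (unfold lambda; rewrite (dot_comm (e u)); field; exact hskew).
  split; try assumption; try lra.
  - rewrite (dot_frame _ _ (vderive s u) (vderive (vderive e) u) hee hnn hen) in hs2n.
    rewrite hs1e, hstr, hs1z, he2z in hs2n.
    replace (dot (vderive (vderive e) u) (e u)) with (-1) in hs2n by lra.
    lra.
  - rewrite (is_derive_unique _ _ _ (is_derive_distribution_parameter s e u he0 hs1 he1)).
    (* [(e, e'', s') = k (e, z, s') = - k s'.n = 0] *)
    assert (E : triple (e u) (vderive (vderive e) u) (vderive s u) = 0).
    { replace (triple (e u) (vderive (vderive e) u) (vderive s u))
        with (- dot (vderive (vderive e) u) (cross (e u) (vderive s u))) by vec_ring.
      rewrite (dot_frame _ _ (vderive (vderive e) u) _ hee hnn hen).
      replace (dot (cross (e u) (vderive s u)) (e u)) with 0 by vec_ring.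
      rewrite (dot_cross_cross (e u) (vderive s u)), hstr, hen.
      replace (dot (vderive (vderive e) u) (vderive e u)) with 0 by lra.
      ring. }
    rewrite E; ring.
Qed.

(** * The fundamental forms *)

Lemma fundamental_forms (I : R -> Prop) (s e : R -> vec) :
  open I -> skew_ruled_surface I s e -> forall u v, I u ->
  let k := conical_curvature e u in
  let d := distribution_parameter s e u in
  let l := lambda s e u in
  let X := ruled s e in
  g11 X u v = v ^ 2 + d ^ 2 * (l ^ 2 + 1) /\ g12 X u v = d * l /\ g22 X u v = 1 /\
  h11 X u v = - (k * v ^ 2 + Derive (distribution_parameter s e) u * v
                 + d ^ 2 * (k - l)) / w s e u v /\
  h12 X u v = d / w s e u v /\ h22 X u v = 0.
Proof.
  intros hI hPhi u v hu k d l X.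
  assert (hd := ruled_derivable I s e hI (srs_C3 _ _ _ hPhi)).
  assert (hXu : forall r, I r -> dfst X r v = plus (vderive s r) (scal v (vderive e r))).
  { intros r hr; destruct (hd r hr) as (? & ? & _).
    exact (vderive_plus_scal s e v r ltac:(assumption) ltac:(assumption)). }
  assert (hXv : dsnd X u v = e u) by apply dsnd_ruled.
  assert (hXuu : dfst (dfst X) u v
                 = plus (vderive (vderive s) u) (scal v (vderive (vderive e) u))).
  { destruct (hd u hu) as (_ & _ & ? & ?).
    rewrite <- vderive_plus_scal by assumption.
    apply vderive_ext_loc, (filter_imp I); [exact hXu|exact (hI u hu)]. }
  assert (hXuv : dfst (dsnd X) u v = vderive e u).
  { apply (vderive_ext_loc (fun t => dsnd X t v) e), filter_forall.
    intros r; apply dsnd_ruled. }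
  assert (hXvv : dsnd (dsnd X) u v = (0, 0, 0)).
  { transitivity (vderive (fun _ => e u) v).
    - apply vderive_ext_loc, filter_forall; intros r; apply dsnd_ruled.
    - unfold vderive; now rewrite !Derive_const. }
  destruct (skew_frame_equations I s e hI hPhi u hu)
    as [hee hnn hen hs1e hs1n hs1z he2e he2n he2z hs2n hs2z].
  fold k in he2z, hs2n; fold d in hs1e, hs1z, hs2n; fold l in hs1e, hs2n.
  set (n := vderive e u) in *; set (z := cross (e u) n) in *.
  set (Xu := plus (vderive s u) (scal v n)).
  (* [X_u x X_v = delta n - v z] *)
  set (m := cross Xu (e u)).
  assert (hme : dot m (e u) = 0) by (unfold m; vec_ring).
  assert (hmn : dot m n = d).
  { replace (dot m n) with (dot Xu z) by (unfold m, z; vec_ring).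
    unfold Xu; rewrite dot_plus_scal_l, hs1z.
    replace (dot n z) with 0 by (unfold z; vec_ring); ring. }
  assert (hmz : dot m z = - v).
  { unfold m, z; rewrite dot_cross_cross, hee, hen; unfold Xu.
    rewrite !dot_plus_scal_l, hs1n, hnn; ring. }
  assert (hm : enorm m = w s e u v).
  { unfold enorm, w; f_equal; rewrite (dot_frame _ _ m m hee hnn hen).
    fold z; rewrite hme, hmn, hmz; fold d; ring. }
  assert (hN : unit_normal X u v = scal (/ w s e u v) m).
  { unfold unit_normal; rewrite hXu, hXv by exact hu.
    fold n Xu m; now rewrite hm. }
  assert (hdot : forall p, dot p (unit_normal X u v) = (d * dot p n - v * dot p z) / w s e u v).
  { intros p; rewrite hN, dot_scal_r, (dot_frame _ _ p m hee hnn hen).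
    fold z; rewrite hme, hmn, hmz; unfold Rdiv; ring. }
  unfold g11, g12, g22, h11, h12, h22; rewrite !hdot.
  rewrite hXuu, hXuv, hXvv, hXv, !hXu by exact hu.
  fold n z Xu; rewrite (dot_frame _ _ Xu Xu hee hnn hen); fold z.
  unfold Xu; rewrite !dot_plus_scal_l, hs1e, hs1n, hs1z, hs2n, hs2z, he2n, he2z, hee, hnn.
  rewrite (dot_comm n (e u)), hen.
  replace (dot n z) with 0 by (unfold z; vec_ring).
  replace (dot (0, 0, 0) n) with 0 by vec_ring.
  replace (dot (0, 0, 0) z) with 0 by vec_ring.
  unfold Rdiv; repeat split; ring.
Qed.

(** * The normal curvature condition at one generator *)

Lemma powerRZ_2_eq_1 (m : Z) : powerRZ 2 m = 1 -> m = 0%Z.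
Proof.
  assert (H : forall p, 1 < 2 ^ Pos.to_nat p) by (intros p; apply Rlt_pow_R1; lra || lia).
  destruct m as [|p|p]; cbn; intros h; [reflexivity|..]; specialize (H p).
  - lra.
  - assert (2 ^ Pos.to_nat p * / 2 ^ Pos.to_nat p = 1) by (apply Rinv_r; lra).
    rewrite h in *; lra.
Qed.

(** A relation [k 4^j - l + F (4 y)^j + F l^2 y^j = 0] for [j = 1, ..., 4].  With
    [E] the shift in [j], the operator [(E - 1) (E - 4) (E - y)] kills every
    term but [F (4 y)^j], which it multiplies by [(4 y - 1) (4 y - 4) (3 y)]; so
    [y] is [1] or [1/4].  In the latter case [k 4^j + (F - l) + F l^2 4^(-j) = 0],
    that is [k = F l^2 = 0] and [l = F], contradicting [F <> 0]. *)
Lemma exponential_relation (k l F y : R) :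
  0 < y -> F <> 0 ->
  k * 4 - l = - F * y * (4 + l ^ 2) ->
  k * 16 - l = - F * y ^ 2 * (16 + l ^ 2) ->
  k * 64 - l = - F * y ^ 3 * (64 + l ^ 2) ->
  k * 256 - l = - F * y ^ 4 * (256 + l ^ 2) ->
  y = 1.
Proof.
  intros hy hF h1 h2 h3 h4.
  assert (H : (F * y ^ 2) * ((4 * y - 1) * (y - 1)) = 0).
  { assert (H : 48 * ((F * y ^ 2) * ((4 * y - 1) * (y - 1))) =
      (k * 256 - l + F * y ^ 4 * (256 + l ^ 2))
      - (5 + y) * (k * 64 - l + F * y ^ 3 * (64 + l ^ 2))
      + (4 + 5 * y) * (k * 16 - l + F * y ^ 2 * (16 + l ^ 2))
      - 4 * y * (k * 4 - l + F * y * (4 + l ^ 2))) by ring.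
    rewrite h1, h2, h3, h4 in H; lra. }
  apply Rmult_integral in H; destruct H as [H|H].
  { exfalso; apply Rmult_integral in H; destruct H as [H|H]; [lra|nra]. }
  apply Rmult_integral in H; destruct H as [H|H]; [exfalso|lra].
  assert (y = / 4) by lra; subst y.
  assert (hFl : F * l ^ 2 = 0) by lra.
  assert (hl : l = F) by lra.
  subst l; apply hF.
  clear H; assert (H : F * F * F = 0) by lra.
  apply Rmult_integral in H; destruct H as [H|H]; [|exact H].
  apply Rmult_integral in H; now destruct H.
Qed.

(** The normal curvature along [dK = 0], pointwise in [u].  On the line
    [v -> (u, v)] the condition is an identity between a rational function of
    [v] and a power of [w]; sampling it where [w = |d| 2 ^ j] makes
    [w ^ n] a geometric progression, whatever the sign and parity of [n]. *)
Lemma generator_condition (k d d1 l f : R) (n : Z) :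
  d <> 0 ->
  (forall v du dv,
     (d1 * (d ^ 2 - v ^ 2), 2 * d * v) <> (0, 0) ->
     (du, dv) <> (0, 0) ->
     d1 * (d ^ 2 - v ^ 2) * du + 2 * d * v * dv = 0 ->
     (- (k * v ^ 2 + d1 * v + d ^ 2 * (k - l)) / sqrt (v ^ 2 + d ^ 2) * du ^ 2
      + 2 * (d / sqrt (v ^ 2 + d ^ 2)) * du * dv + 0 * dv ^ 2)
     / ((v ^ 2 + d ^ 2 * (l ^ 2 + 1)) * du ^ 2 + 2 * (d * l) * du * dv + 1 * dv ^ 2)
     = f * powerRZ (sqrt (v ^ 2 + d ^ 2)) n) ->
  (f = 0 /\ k = 0 /\ l = 0 /\ d1 = 0) \/
  (n = (-1)%Z /\ f = - k /\ d1 = 0 /\ l * (k * l + 1) = 0).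
Proof.
  intros hd H.
  assert (hd2 : 0 < d ^ 2) by nra.
  assert (hw : forall v, 0 < sqrt (v ^ 2 + d ^ 2)) by (intros v; apply sqrt_lt_R0; nra).
  destruct (Req_dec f 0) as [hf|hf]; [left|right].
  - assert (N : forall v, v <> 0 -> k * v ^ 3 + d ^ 2 * (k - l) * v + d1 * d ^ 2 = 0).
    (* the numerator is [- 4 d^2 v / w] times this cubic *)
    { intros v hv; specialize (hw v).
      assert (hdv : d * v <> 0) by (apply Rmult_integral_contrapositive; now split).
      specialize (H v (2 * d * v) (d1 * (v ^ 2 - d ^ 2))
        ltac:(intros E; injection E; lra) ltac:(intros E; injection E; lra) ltac:(ring)).
      rewrite hf, (Rmult_0_l (powerRZ _ _)) in H.
      set (W := sqrt (v ^ 2 + d ^ 2)) in *.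
      set (dv := d1 * (v ^ 2 - d ^ 2)) in *.
      match type of H with ?A / ?B = 0 =>
        assert (hB : B = (v ^ 2 + d ^ 2) * (2 * d * v) ^ 2 + (d * l * (2 * d * v) + dv) ^ 2)
          by ring;
        assert (hA : A = - 4 * (d ^ 2 * v / W) *
           (k * v ^ 3 + d ^ 2 * (k - l) * v + d1 * d ^ 2))
          by (unfold dv; field; lra);
        rewrite hA, hB in H
      end.
      assert (0 < (v ^ 2 + d ^ 2) * (2 * d * v) ^ 2)
        by (apply Rmult_lt_0_compat; [nra|apply pow2_gt_0; lra]).
      assert (hB2 := pow2_ge_0 (d * l * (2 * d * v) + dv)).
      apply Rmult_integral in H; destruct H as [H|H];
        [|exfalso; revert H; apply Rinv_neq_0_compat; lra].
      apply Rmult_integral in H; destruct H as [H|H]; [exfalso|exact H].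
      assert (hq : d ^ 2 * v / W <> 0).
      { apply Rmult_integral_contrapositive; split; [|apply Rinv_neq_0_compat; lra].
        apply Rmult_integral_contrapositive; split; [lra|exact hv]. }
      lra. }
    assert (N1 := N 1 ltac:(lra)); assert (N2 := N (-1) ltac:(lra)).
    assert (N3 := N 2 ltac:(lra)).
    assert (hk : k = 0) by lra.
    assert (hz : forall x, d ^ 2 * x = 0 -> x = 0).
    { intros x hx; apply Rmult_integral in hx; destruct hx; [lra|assumption]. }
    repeat split; [exact hf|exact hk|apply hz; nra|apply hz; nra].
  - assert (hd1 : d1 = 0).
    { destruct (Req_dec d1 0) as [h|h]; [exact h|exfalso].
      (* at [v = 0] the prescribed direction is that of the generator, [du = 0] *)
      specialize (H 0 0 1); specialize (hw 0).
      assert (hne : d1 * (d ^ 2 - 0 ^ 2) <> 0)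
        by (apply Rmult_integral_contrapositive; split; [exact h|lra]).
      specialize (H ltac:(intros E; injection E; intros; lra)
                    ltac:(intros E; injection E; lra) ltac:(ring)).
      assert (hp := powerRZ_lt _ n hw).
      assert (hz : f * powerRZ (sqrt (0 ^ 2 + d ^ 2)) n = 0)
        by (rewrite <- H; field; lra).
      apply Rmult_integral in hz; destruct hz; lra. }
    subst d1.
    assert (hab : 0 < Rabs d) by (apply Rabs_pos_lt, hd).
    set (F := f * powerRZ (Rabs d) (n + 1)).
    assert (S : forall c, 1 < c ->
              k * c ^ 2 - l = - F * powerRZ c (n + 1) * (c ^ 2 + l ^ 2)).
    { intros c hc.
      set (v := Rabs d * sqrt (c ^ 2 - 1)).
      assert (hv2 : v ^ 2 = d ^ 2 * (c ^ 2 - 1)).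
      { unfold v; rewrite Rpow_mult_distr, pow2_abs, pow2_sqrt by nra; ring. }
      assert (hv : v <> 0).
      { intros E; rewrite E in hv2.
        assert (0 < d ^ 2 * (c ^ 2 - 1)) by (apply Rmult_lt_0_compat; nra); lra. }
      assert (hW : sqrt (v ^ 2 + d ^ 2) = Rabs d * c).
      { replace (v ^ 2 + d ^ 2) with ((Rabs d * c) ^ 2)
          by (rewrite Rpow_mult_distr, pow2_abs, hv2; ring).
        apply sqrt_pow2; nra. }
      assert (hdv : d * v <> 0) by (apply Rmult_integral_contrapositive; now split).
      specialize (H v 1 0 ltac:(intros E; injection E; lra)
                    ltac:(intros E; injection E; lra) ltac:(ring)).
      rewrite hW, hv2 in H.
      assert (hp : powerRZ (Rabs d * c) (n + 1) = powerRZ (Rabs d * c) n * (Rabs d * c))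
        by (rewrite powerRZ_add by nra; rewrite powerRZ_1; reflexivity).
      unfold F; rewrite !Ropp_mult_distr_l_reverse, (Rmult_assoc f), <- powerRZ_mult, hp.
      replace (f * (powerRZ (Rabs d * c) n * (Rabs d * c)))
        with (f * powerRZ (Rabs d * c) n * (Rabs d * c)) by ring.
      rewrite <- H.
      assert (0 < d ^ 2 * (c ^ 2 + l ^ 2)).
      { apply Rmult_lt_0_compat; [exact hd2|].
        assert (hc2 := pow2_gt_0 c ltac:(lra)); assert (hl2 := pow2_ge_0 l); lra. }
      field; repeat split; lra. }
    assert (hF : F <> 0).
    { apply Rmult_integral_contrapositive; split; [exact hf|].
      apply powerRZ_NOR; lra. }
    assert (hn : (n + 1 = 0)%Z).
    { apply powerRZ_2_eq_1.
      assert (S1 := S 2 ltac:(lra)); assert (S2 := S (2 * 2) ltac:(lra)).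
      assert (S3 := S (2 * (2 * 2)) ltac:(lra)).
      assert (S4 := S (2 * (2 * (2 * 2))) ltac:(lra)).
      assert (hy := powerRZ_lt 2 (n + 1) ltac:(lra)).
      repeat rewrite powerRZ_mult in S2; repeat rewrite powerRZ_mult in S3.
      repeat rewrite powerRZ_mult in S4.
      generalize dependent (powerRZ 2 (n + 1)); intros y S1 S2 S3 S4 hy.
      apply (exponential_relation k l F); [exact hy|exact hF|lra..]. }
    assert (hF' : F = f) by (unfold F; rewrite hn; cbn; ring).
    rewrite hn, hF' in S; cbn in S.
    assert (S1 := S 2 ltac:(lra)); assert (S2 := S 4 ltac:(lra)).
    assert (hfk : f = - k) by lra.
    repeat split; [lia|exact hfk|].
    rewrite hfk in S1; lra.
Qed.

(** * Connectedness of the parameter interval *)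

(** Otherwise the value [- 1 / 2] would be attained. *)
Lemma two_valued_constant (a b : Rbar) (g : R -> R) :
  (forall u, rbar_interval a b u -> continuous g u) ->
  (forall u, rbar_interval a b u -> g u * (g u + 1) = 0) ->
  (forall u, rbar_interval a b u -> g u = 0) \/
  (forall u, rbar_interval a b u -> g u = -1).
Proof.
  intros hc h.
  assert (no_jump : forall (c x y : R), c <> 0 -> rbar_interval a b x -> rbar_interval a b y ->
            x < y -> c * (g x + / 2) < 0 -> 0 < c * (g y + / 2) -> False).
  { intros c x y hc0 [hx _] [_ hy] hxy hgx hgy.
    assert (hI : forall t, x <= t <= y -> rbar_interval a b t).
    { intros t [h1 h2]; split;
        [exact (Rbar_lt_le_trans a x t hx h1)|exact (Rbar_le_lt_trans t y b h2 hy)]. }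
    destruct (IVT_interv (fun t => c * (g t + / 2)) x y) as (t & ht & hgt); try assumption.
    - intros t ht; apply continuity_pt_filterlim.
      apply (continuous_mult (fun _ => c) (fun r => g r + / 2)); [apply continuous_const|].
      apply (continuous_plus g (fun _ => / 2)); [exact (hc t (hI t ht))|apply continuous_const].
    - specialize (h t (hI t ht)).
      apply Rmult_integral in hgt; destruct hgt as [hgt|hgt]; [exact (hc0 hgt)|].
      replace (g t) with (- / 2) in h by lra; lra. }
  destruct (classic (forall u, rbar_interval a b u -> g u = 0)) as [h0|h0]; [now left|].
  right; intros y hy.
  apply not_all_ex_not in h0; destruct h0 as [x hx].
  apply imply_to_and in hx; destruct hx as [hx hgx].
  assert (hgx1 : g x = -1)
    by (specialize (h x hx); apply Rmult_integral in h; destruct h; [easy|lra]).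
  assert (hgy := h y hy); apply Rmult_integral in hgy.
  destruct hgy as [hgy|hgy]; [exfalso|lra].
  destruct (Rtotal_order x y) as [hxy|[hxy|hxy]].
  - apply (no_jump 1 x y); auto; lra.
  - subst y; lra.
  - apply (no_jump (-1) y x); auto; lra.
Qed.

(** * The osculating quadric of an Edlinger surface *)

Definition revolution_quadric (center axis : vec) (al be : R) (p : vec) : R :=
  let d := minus p center in
  (dot d d - dot d axis ^ 2) / al ^ 2 - dot d axis ^ 2 / be ^ 2 - 1.

Lemma quadratic_revolution_quadric (center axis : vec) (al be : R) :
  quadratic_polynomial (revolution_quadric center axis al be).
Proof.
  set (A := / al ^ 2); set (B := / al ^ 2 + / be ^ 2).
  set (m := dot center axis).
  exists (A - B * coord1 axis ^ 2), (A - B * coord2 axis ^ 2), (A - B * coord3 axis ^ 2),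
    (- (2 * B * coord1 axis * coord2 axis)), (- (2 * B * coord1 axis * coord3 axis)),
    (- (2 * B * coord2 axis * coord3 axis)),
    (2 * B * m * coord1 axis - 2 * A * coord1 center),
    (2 * B * m * coord2 axis - 2 * A * coord2 center),
    (2 * B * m * coord3 axis - 2 * A * coord3 center),
    (A * dot center center - B * m ^ 2 - 1).
  intros p; unfold revolution_quadric, Rdiv, m, B, A, dot.
  destruct p as ((p1 & p2) & p3), center as ((c1 & c2) & c3), axis as ((a1 & a2) & a3).
  unfold coord1, coord2, coord3, minus, plus, opp; cbn; unfold plus, opp; cbn; ring.
Qed.

Lemma dot_minus_l (p q r : vec) : dot (minus p q) r = dot p r - dot q r.
Proof.
  unfold dot, coord1, coord2, coord3, minus, plus, opp; cbn; unfold plus, opp; cbn; ring.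
Qed.

Lemma is_derive_dot_const (p : R -> vec) (c : vec) (t : R) :
  vderivable p t -> is_derive (fun r => dot (p r) c) t (dot (vderive p t) c).
Proof.
  intros hp.
  assert (hc : vderivable (fun _ => c) t) by (repeat split; apply ex_derive_const).
  assert (H := is_derive_dot p (fun _ => c) t hp hc).
  assert (E : vderive (fun _ => c) t = (0, 0, 0)) by (unfold vderive; now rewrite !Derive_const).
  cbv beta in H; rewrite E in H.
  replace (dot (p t) (0, 0, 0)) with 0 in H by vec_ring.
  now rewrite Rplus_0_r in H.
Qed.

Lemma is_derive_revolution_quadric (center axis : vec) (al be : R) (x : R -> vec) (t : R) :
  vderivable x t ->
  is_derive (fun r => revolution_quadric center axis al be (x r)) t
    (2 * (dot (minus (x t) center) (vderive x t) / al ^ 2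
          - (/ al ^ 2 + / be ^ 2) * dot (minus (x t) center) axis * dot (vderive x t) axis)).
Proof.
  intros hx.
  apply (is_derive_ext (fun r =>
    (dot (x r) (x r) - 2 * dot (x r) center + dot center center) / al ^ 2
    - (/ al ^ 2 + / be ^ 2) * (dot (x r) axis - dot center axis) ^ 2 - 1)).
  { intros r; unfold revolution_quadric; cbv zeta.
    rewrite dot_minus_l, (dot_comm (x r) (minus _ _)), (dot_comm center (minus _ _)).
    rewrite !dot_minus_l, (dot_comm center (x r)); unfold Rdiv; real_ring. }
  rewrite !dot_minus_l, (dot_comm center (vderive x t)).
  set (xx := fun r => dot (x r) (x r)).
  set (xc := fun r => dot (x r) center).
  set (xa := fun r => dot (x r) axis).
  assert (h1 : is_derive xx t (dot (vderive x t) (x t) + dot (x t) (vderive x t)))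
    by exact (is_derive_dot x x t hx hx).
  assert (h2 : is_derive xc t (dot (vderive x t) center))
    by exact (is_derive_dot_const x center t hx).
  assert (h3 : is_derive xa t (dot (vderive x t) axis))
    by exact (is_derive_dot_const x axis t hx).
  rewrite (dot_comm (vderive x t) (x t)) in h1.
  change (is_derive (fun r => (xx r - 2 * xc r + dot center center) / al ^ 2
    - (/ al ^ 2 + / be ^ 2) * (xa r - dot center axis) ^ 2 - 1) t
    (2 * ((dot (x t) (vderive x t) - dot (vderive x t) center) / al ^ 2
          - (/ al ^ 2 + / be ^ 2) * (xa t - dot center axis)
            * dot (vderive x t) axis))).
  clearbody xx xc xa.
  auto_derive; [repeat split; eexists; eassumption|].
  eta_derive; rewrite (is_derive_unique _ _ _ h1), (is_derive_unique _ _ _ h2),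
    (is_derive_unique _ _ _ h3).
  unfold Rdiv; cbn [pow]; ring.
Qed.

Lemma Derive_2_revolution_quadric (I : R -> Prop) (center axis : vec) (al be : R)
    (x : R -> vec) (t : R) :
  open I -> (forall r, I r -> vderivable x r /\ vderivable (vderive x) r) -> I t ->
  Derive_n (fun r => revolution_quadric center axis al be (x r)) 2 t =
  2 * ((dot (vderive x t) (vderive x t)
        + dot (minus (x t) center) (vderive (vderive x) t)) / al ^ 2
       - (/ al ^ 2 + / be ^ 2) *
         (dot (vderive x t) axis ^ 2
          + dot (minus (x t) center) axis * dot (vderive (vderive x) t) axis)).
Proof.
  intros hI hx ht; cbn [Derive_n].
  rewrite (Derive_ext_loc _ (fun r =>
    2 * ((dot (x r) (vderive x r) - dot (vderive x r) center) / al ^ 2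
         - (/ al ^ 2 + / be ^ 2) * (dot (x r) axis - dot center axis)
           * dot (vderive x r) axis))).
  2:{ apply (filter_imp I); [|exact (hI t ht)].
      intros r hr; destruct (hx r hr) as [h _].
      transitivity (2 * (dot (minus (x r) center) (vderive x r) / al ^ 2
          - (/ al ^ 2 + / be ^ 2) * dot (minus (x r) center) axis * dot (vderive x r) axis)).
      - exact (is_derive_unique _ _ _ (is_derive_revolution_quadric center axis al be x r h)).
      - rewrite !dot_minus_l, (dot_comm center (vderive x r)); reflexivity. }
  destruct (hx t ht) as [h0 h1].
  rewrite !dot_minus_l, (dot_comm center (vderive (vderive x) t)).
  apply is_derive_unique.
  set (xx := fun r => dot (x r) (vderive x r)).
  set (xc := fun r => dot (vderive x r) center).
  set (xa := fun r => dot (x r) axis).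
  set (ya := fun r => dot (vderive x r) axis).
  assert (d1 : is_derive xx t
    (dot (vderive x t) (vderive x t) + dot (x t) (vderive (vderive x) t)))
    by exact (is_derive_dot x (vderive x) t h0 h1).
  assert (d2 : is_derive xc t (dot (vderive (vderive x) t) center))
    by exact (is_derive_dot_const (vderive x) center t h1).
  assert (d3 : is_derive xa t (dot (vderive x t) axis))
    by exact (is_derive_dot_const x axis t h0).
  assert (d4 : is_derive ya t (dot (vderive (vderive x) t) axis))
    by exact (is_derive_dot_const (vderive x) axis t h1).
  change (is_derive (fun r => 2 * ((xx r - xc r) / al ^ 2
    - (/ al ^ 2 + / be ^ 2) * (xa r - dot center axis) * ya r)) t
    (2 * ((dot (vderive x t) (vderive x t)
        + (dot (x t) (vderive (vderive x) t) - dot (vderive (vderive x) t) center)) / al ^ 2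
       - (/ al ^ 2 + / be ^ 2) *
         (dot (vderive x t) axis * (ya t * 1)
          + (xa t - dot center axis) * dot (vderive (vderive x) t) axis)))).
  clearbody xx xc xa ya.
  auto_derive; [repeat split; eexists; eassumption|].
  eta_derive; rewrite (is_derive_unique _ _ _ d1), (is_derive_unique _ _ _ d2),
    (is_derive_unique _ _ _ d3), (is_derive_unique _ _ _ d4).
  unfold Rdiv; cbn [pow]; ring.
Qed.

(** In the coordinates [x, y, t] of the frame at the striction point, contact of
    second order along the generator forces the osculating quadric to be
    [- k y^2 - (lambda + k) t^2 + 2 x t - 2 delta y = 0] when [delta' = 0].
    For [lambda = - 1 / k] its quadratic part has the eigenvalues [- k] (twice)
    and [1 / k], the latter with eigenvector [k e + z]; completing the square
    puts the center at [s - (delta / k) n], with radius [|delta / k|] of the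
    gorge circle and other semi-axis [|delta|]. *)
Lemma edlinger_of_invariants (I : R -> Prop) (s e : R -> vec) :
  open I -> skew_ruled_surface I s e -> constant_delta I s e ->
  (forall u, I u -> conical_curvature e u * lambda s e u = -1) -> edlinger I s e.
Proof.
  intros hI hPhi hd1 hkl u hu.
  assert (hder := ruled_derivable I s e hI (srs_C3 _ _ _ hPhi)).
  assert (hd : distribution_parameter s e u <> 0) by exact (srs_skew _ _ _ hPhi u hu).
  destruct (skew_frame_equations I s e hI hPhi u hu)
    as [hee hnn hen hs1e hs1n hs1z he2e he2n he2z hs2n hs2z].
  specialize (hd1 u hu); specialize (hkl u hu).
  rewrite hd1 in hs2z.
  set (k := conical_curvature e u) in *; set (d := distribution_parameter s e u) in *.
  set (n := vderive e u) in *; set (z := cross (e u) n) in *.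
  assert (hk : k <> 0) by (intros E; rewrite E in hkl; lra).
  assert (hl : lambda s e u = - / k)
    by (apply (Rmult_eq_reg_l k); [rewrite hkl; field|]; exact hk).
  rewrite hl in hs1e, hs2n.
  assert (hk1 : 0 < 1 + k ^ 2) by nra.
  set (r := sqrt (1 + k ^ 2)).
  assert (hr : 0 < r) by (apply sqrt_lt_R0, hk1).
  assert (hr2 : r ^ 2 = 1 + k ^ 2) by (apply pow2_sqrt; lra).
  set (A := scal (/ r) (plus z (scal k (e u)))).
  set (c := plus (s u) (scal (- (d / k)) n)).
  assert (hA : forall p, dot p A = (dot p z + k * dot p (e u)) / r)
    by (intros p; unfold A; rewrite dot_scal_r, dot_plus_scal_r; unfold Rdiv; ring).
  assert (hAA : forall p q, dot p A * dot q A =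
      (dot p z + k * dot p (e u)) * (dot q z + k * dot q (e u)) / (1 + k ^ 2))
    by (intros p q; rewrite !hA, <- hr2; field; lra).
  assert (hne : dot n (e u) = 0) by (rewrite dot_comm; exact hen).
  assert (hez : dot (e u) z = 0) by (unfold z; vec_ring).
  assert (hnz : dot n z = 0) by (unfold z; vec_ring).
  assert (hc : forall v p, dot (minus (ruled s e u v) c) p
                           = v * dot p (e u) + d / k * dot p n).
  { intros v p; rewrite dot_minus_l; unfold ruled, c; rewrite !dot_plus_scal_l.
    rewrite (dot_comm (e u) p), (dot_comm n p); ring. }
  assert (hal : Rabs (d / k) ^ 2 = d ^ 2 / k ^ 2) by (rewrite pow2_abs; field; exact hk).
  exists (revolution_quadric c A (Rabs (d / k)) (Rabs d)); split; [split; [|split]|].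
  - apply quadratic_revolution_quadric.
  - exists c; unfold revolution_quadric; cbv zeta.
    assert (hcc : forall p, dot (minus c c) p = 0)
      by (intros p; rewrite dot_minus_l; ring).
    rewrite !hcc; unfold Rdiv; lra.
  - intros v i hi.
    set (x := fun t => ruled s e t v).
    assert (hx : forall t, I t -> vderivable x t /\
               vderive x t = plus (vderive s t) (scal v (vderive e t))).
    { intros t ht; destruct (hder t ht) as (? & ? & _); split;
        [apply vderivable_plus_scal|apply vderive_plus_scal]; assumption. }
    assert (hx2 : forall t, I t -> vderivable (vderive x) t /\
       vderive (vderive x) t = plus (vderive (vderive s) t) (scal v (vderive (vderive e) t))).
    { intros t ht; destruct (hder t ht) as (_ & _ & ? & ?).
      assert (E : locally t (fun r => plus (vderive s r) (scal v (vderive e r)) = vderive x r)).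
      { apply (filter_imp I); [|exact (hI t ht)].
        intros r' hr'; symmetry; apply hx, hr'. }
      split.
      - apply (vderivable_ext_loc _ _ _ E), vderivable_plus_scal; assumption.
      - rewrite <- (vderive_ext_loc _ _ _ E); apply vderive_plus_scal; assumption. }
    destruct (hx u hu) as [hxu hx1]; destruct (hx2 u hu) as [_ hx2u].
    fold n in hx1.
    assert (hx1e : dot (vderive x u) (e u) = - (d / k))
      by (rewrite hx1, dot_plus_scal_l, hs1e, hne; field; exact hk).
    assert (hx1n : dot (vderive x u) n = v)
      by (rewrite hx1, dot_plus_scal_l, hs1n, hnn; ring).
    assert (hx1z : dot (vderive x u) z = d)
      by (rewrite hx1, dot_plus_scal_l, hs1z, hnz; ring).
    assert (hx2n : dot (vderive (vderive x) u) n = d * (- / k - k))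
      by (rewrite hx2u, dot_plus_scal_l, hs2n, he2n; ring).
    assert (hx2z : dot (vderive (vderive x) u) z = v * k)
      by (rewrite hx2u, dot_plus_scal_l, hs2z, he2z; ring).
    assert (hx11 := dot_frame (e u) n (vderive x u) (vderive x u) hee hnn hen).
    fold z in hx11; rewrite hx1e, hx1n, hx1z in hx11.
    assert (hcA : forall p, dot (minus (x u) c) A * dot p A
               = k * v * (dot p z + k * dot p (e u)) / (1 + k ^ 2)).
    { intros p; rewrite hAA; unfold x; rewrite !hc, hee, (dot_comm z (e u)), hez,
        (dot_comm z n), hnz, hen; unfold Rdiv; ring. }
    assert (hx1A : dot (vderive x u) A = 0) by (rewrite hA, hx1e, hx1z; field; split; lra).
    assert (hAx : forall p, dot (minus (x u) c) p = v * dot p (e u) + d / k * dot p n)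
      by exact (hc v).
    destruct i as [|[|[|i]]]; [..|exfalso; lia].
    + cbn [Derive_n]; unfold revolution_quadric; cbv zeta.
      change (ruled s e u v) with (x u); set (D := minus (x u) c) in *.
      assert (hDe : dot D (e u) = v) by (rewrite hAx, hee, hen; ring).
      assert (hDn : dot D n = d / k) by (rewrite hAx, hne, hnn; ring).
      assert (hDz : dot D z = 0)
        by (rewrite hAx, (dot_comm z (e u)), (dot_comm z n), hez, hnz; ring).
      replace (dot D A ^ 2) with (dot D A * dot D A) by ring.
      rewrite hcA, hal, pow2_abs, hAx, hDe, hDn, hDz.
      field; repeat split; lra.
    + cbn [Derive_n].
      rewrite (is_derive_unique _ _ _ (is_derive_revolution_quadric c A _ _ x u hxu)).
      rewrite hx1A, hAx, hx1e, hx1n; unfold Rdiv; ring.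
    + rewrite (Derive_2_revolution_quadric I c A _ _ x u hI); [|intros t ht; split|exact hu].
      * rewrite hx1A, hcA, hAx, hx11, hx2n, hx2z, hal, pow2_abs.
        field; repeat split; lra.
      * apply hx, ht.
      * apply hx2, ht.
  - exists c, A, (Rabs (d / k)), (Rabs d); repeat split.
    + unfold enorm; rewrite <- sqrt_1; f_equal.
      assert (hzz : dot z z = 1)
        by (unfold z; rewrite dot_cross_cross, hee, hnn, hen; ring).
      rewrite hA, (dot_comm A z), (dot_comm A (e u)), !hA, (dot_comm z (e u)), hez, hee, hzz.
      transitivity ((1 + k ^ 2) / r ^ 2); [field; lra|rewrite hr2; field; lra].
    + apply Rabs_pos_lt, Rmult_integral_contrapositive; split;
        [exact hd|apply Rinv_neq_0_compat, hk].
    + apply Rabs_pos_lt, hd.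
    + unfold revolution_quadric; cbv zeta; intros; lra.
    + unfold revolution_quadric; cbv zeta; intros; lra.
Qed.

(** * The classification *)

Lemma normal_curvature_condition (I : R -> Prop) (s e : R -> vec) (n : Z) (f : R -> R) (u : R) :
  open I -> skew_ruled_surface I s e -> I u ->
  (forall v du dv, cgc_determines_direction s e u v -> cgc_direction s e u v du dv ->
     normal_curvature (ruled s e) u v du dv = f u * powerRZ (w s e u v) n) ->
  let k := conical_curvature e u in
  let l := lambda s e u in
  let d1 := Derive (distribution_parameter s e) u in
  (f u = 0 /\ k = 0 /\ l = 0 /\ d1 = 0) \/
  (n = (-1)%Z /\ f u = - k /\ d1 = 0 /\ l * (k * l + 1) = 0).
Proof.
  intros hI hPhi hu hkN k l d1.
  apply (generator_condition k (distribution_parameter s e u)).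
  - exact (srs_skew _ _ _ hPhi u hu).
  - intros v du dv hdet hne hdir.
    transitivity (normal_curvature (ruled s e) u v du dv);
      [|exact (hkN v du dv hdet (conj hne hdir))].
    destruct (fundamental_forms I s e hI hPhi u v hu) as (e1 & e2 & e3 & e4 & e5 & e6).
    unfold normal_curvature; rewrite e1, e2, e3, e4, e5, e6; reflexivity.
Qed.

Lemma continuous_lambda (I : R -> Prop) (s e : R -> vec) :
  open I -> skew_ruled_surface I s e -> forall u, I u -> continuous (lambda s e) u.
Proof.
  intros hI hPhi u hu.
  destruct (ruled_derivable I s e hI (srs_C3 _ _ _ hPhi) u hu) as (_ & h0 & h1 & h2).
  apply (ex_derive_continuous (lambda s e)); unfold lambda.
  apply ex_derive_div.
  - eexists; exact (is_derive_dot e (vderive s) u h0 h1).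
  - eexists; exact (is_derive_distribution_parameter s e u h0 h1 h2).
  - exact (srs_skew _ _ _ hPhi u hu).
Qed.

Theorem proposition6 (a b : Rbar) (hab : Rbar_lt a b)
  (s e : R -> vec) (hPhi : skew_ruled_surface (rbar_interval a b) s e)
  (n : Z) (f : R -> R)
  (hf : forall u, rbar_interval a b u -> continuous f u)
  (hkN : forall u v du dv : R, rbar_interval a b u ->
     cgc_determines_direction s e u v -> cgc_direction s e u v du dv ->
     normal_curvature (ruled s e) u v du dv = f u * powerRZ (w s e u v) n) :
  ((forall u, rbar_interval a b u -> f u = 0) /\
   helicoid (rbar_interval a b) s e)
  \/
  (n = (-1)%Z /\
   (forall u, rbar_interval a b u -> f u = - conical_curvature e u) /\
   ((orthoid (rbar_interval a b) s e /\ constant_delta (rbar_interval a b) s e)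
    \/ edlinger (rbar_interval a b) s e)).
Proof.
  assert (hI := open_rbar_interval a b).
  assert (H : forall u, rbar_interval a b u -> _) by
    exact (fun u hu => normal_curvature_condition _ s e n f u hI hPhi hu
                         (fun v du dv => hkN u v du dv hu)).
  cbv zeta in H.
  destruct (Z.eq_dec n (-1)) as [hn|hn]; [right|left].
  2:{ assert (H0 : forall u, rbar_interval a b u ->
        f u = 0 /\ conical_curvature e u = 0 /\ lambda s e u = 0 /\
        Derive (distribution_parameter s e) u = 0)
        by (intros u hu; destruct (H u hu) as [h|(h & _)]; [exact h|contradiction]).
      split; intros u hu; apply (H0 u hu). }
  assert (hfk : forall u, rbar_interval a b u -> f u = - conical_curvature e u)
    by (intros u hu; destruct (H u hu) as [(? & ? & _)|(_ & ? & _)]; lra).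
  assert (hd : constant_delta (rbar_interval a b) s e)
    by (intros u hu; destruct (H u hu) as [(_ & _ & _ & ?)|(_ & _ & ? & _)]; assumption).
  assert (hl : forall u, rbar_interval a b u ->
            lambda s e u * (conical_curvature e u * lambda s e u + 1) = 0).
  { intros u hu; destruct (H u hu) as [(_ & _ & E & _)|(_ & _ & _ & E)];
      [rewrite E; ring|exact E]. }
  split; [exact hn|split; [exact hfk|]].
  (* [k lambda = - f lambda]: the regularity of [k] enters through [f] *)
  destruct (two_valued_constant a b (fun u => - f u * lambda s e u)) as [h0|h1].
  - intros u hu.
    apply (continuous_mult (fun t => - f t)).
    + apply (continuous_opp f), hf, hu.
    + exact (continuous_lambda _ s e hI hPhi u hu).
  - intros u hu; rewrite (hfk u hu), Ropp_involutive, Rmult_assoc, hl by exact hu; ring.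
  - left; split; [|exact hd].
    intros u hu; specialize (h0 u hu); specialize (hl u hu).
    rewrite (hfk u hu), Ropp_involutive in h0; rewrite h0 in hl; lra.
  - right; apply edlinger_of_invariants; auto.
    intros u hu; specialize (h1 u hu); rewrite (hfk u hu), Ropp_involutive in h1; exact h1.
Qed.
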